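(* Let $\hat A,\hat N_1,\dots,\hat N_q,\hat X_0,\hat C$ be the reduced-order matrices computed by the Sylvester fixed point iteration (described in the context), assuming that it converged, and let $V,W\in\mathbb R^{n\times\hat n}$ be the associated projection matrices. Then $$\begin{aligned} (i)\quad& V\hat P(T) - \tilde P(T) = V\, \hat{\mathcal L}^{-1}\Big[\hat F(T) - (W^\top V)^{-1} W^\top \tilde F(T)\Big],\\ (ii)\quad& W (V^\top W)^{-1}\hat Q(T) - \tilde Q(T) = W (V^\top W)^{-1}\, \hat{\mathcal L}^{-*}\Big[\hat G(T) - V^\top \tilde G(T)\Big], \end{aligned}$$ meaning that $$V\hat F\approx\tilde F\quad\text{and}\quad W(V^\top W)^{-1}\hat G\approx\tilde G$$ on average with respect to the probability measure $\frac{dt}{T}$ on $[0,T]$, given that $$V\hat F(T)\approx\tilde F(T)\quad\text{and}\quad W(V^\top W)^{-1}\hat G(T)\approx\tilde G(T).$$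
   Context: Setting. $A,N_1,\dots,N_q\in\mathbb R^{n\times n}$, $X_0\in\mathbb R^{n\times m}$, $C\in\mathbb R^{p\times n}$, $T>0$, and $K_M=(k_{ij})\in\mathbb R^{q\times q}$ is the (symmetric positive semidefinite) covariance matrix of an $\mathbb R^q$-valued square integrable mean-zero Lévy process $M$ ($\mathbb E[M(t)M(t)^\top]=K_Mt$). Reduced matrices are $\hat A,\hat N_i\in\mathbb R^{\hat n\times\hat n}$, $\hat X_0\in\mathbb R^{\hat n\times m}$, $\hat C\in\mathbb R^{p\times\hat n}$. Operators: $\mathcal L(X)=AX+XA^\top+\sum_{i,j=1}^qN_iXN_j^\top k_{ij}$; $\hat{\mathcal L}(X)=\hat AX+X\hat A^\top+\sum_{i,j=1}^q\hat N_iX\hat N_j^\top k_{ij}$; $\tilde{\mathcal L}(X)=AX+X\hat A^\top+\sum_{i,j=1}^qN_iX\hat N_j^\top k_{ij}$ (for $X\in\mathbb R^{n\times\hat n}$). Frobenius adjoints: $\hat{\mathcal L}^*(X)=\hat A^\top X+X\hat A+\sum_{i,j=1}^q\hat N_i^\top X\hat N_jk_{ij}$, $\tilde{\mathcal L}^*(X)=A^\top X+X\hat A+\sum_{i,j=1}^qN_i^\top X\hat N_jk_{ij}$. $\hat{\mathcal L}^{-*}$ denotes $(\hat{\mathcal L}^* )^{-1}$. Throughout, $\mathcal L$ and $\hat{\mathcal L}$ are assumed invertible. Covariance functions (solutions of linear matrix ODEs on $[0,T]$): $\dot{\hat F}=\hat{\mathcal L}[\hat F]$, $\hat F(0)=\hat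 X_0\hat X_0^\top$; $\dot{\tilde F}=\tilde{\mathcal L}[\tilde F]$, $\tilde F(0)=X_0\hat X_0^\top$; $\dot{\hat G}=\hat{\mathcal L}^*[\hat G]$, $\hat G(0)=\hat C^\top\hat C$; $\dot{\tilde G}=\tilde{\mathcal L}^*[\tilde G]$, $\tilde G(0)=C^\top\hat C$. Set $\hat P(T)=\int_0^T\hat F(t)\,dt$, $\tilde P(T)=\int_0^T\tilde F(t)\,dt$, $\hat Q(T)=\int_0^T\hat G(t)\,dt$, $\tilde Q(T)=\int_0^T\tilde G(t)\,dt$. Sylvester fixed point iteration. Start from an initial guess for the reduced matrices and repeat the following step until convergence. One step maps reduced matrices $(\hat A,\hat N_i,\hat X_0,\hat C)$ to new ones as follows. (1) Take an invertible matrix $S=S(\hat A,\hat X_0,\hat C,\hat N_i)\in\mathbb R^{\hat n\times\hat n}$ and put $\tilde A=S\hat AS^{-1}$, $\tilde X_0=S\hat X_0$, $\tilde C=\hat CS^{-1}$, $\tilde N_i=S\hat N_iS^{-1}$. (2) Let $X,Y:[0,T]\to\mathbb R^{n\times\hat n}$ solve $\dot X=AX+X\tilde A^\top+\sum_{i,j=1}^qN_iX\tilde N_j^\top k_{ij}$, $X(0)=X_0\tilde X_0^\top$, and $\dot Y=A^\top Y+Y\tilde A+\sum_{i,j=1}^qN_i^\top Y\tilde N_jk_{ij}$, $Y(0)=C^\top\tilde C$. (3) Let $V$ and $W$ be $n\times\hat n$ matrices whose columns are orthonormal bases of $\operatorname{im}[\int_0^TX(t)dt]$ and $\operatorname{im}[\int_0^TY(t)dt]$,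 respectively (so these integrals have full column rank $\hat n$). (4) With $W^\top V$ invertible, return $\hat A=(W^\top V)^{-1}W^\top AV$, $\hat X_0=(W^\top V)^{-1}W^\top X_0$, $\hat C=CV$, $\hat N_i=(W^\top V)^{-1}W^\top N_iV$. ''Converged'' means that the reduced matrices are a fixed point, i.e. the input and output matrices of a step coincide; $V,W$ are the matrices from step (3) of that step, and $\hat{\mathcal L},\tilde{\mathcal L},\hat F,\tilde F,\hat G,\tilde G$ are formed with these reduced matrices. The symbol $\approx$ is used informally, for a small error, without a quantitative specification. Approximation on average with respect to $dt/T$ refers to the time averages, i.e. to the smallness of $V\hat P(T)-\tilde P(T)$ and $W(V^\top W)^{-1}\hat Q(T)-\tilde Q(T)$. *)

(* Defs.v *)
From HB Require Import structures.
From mathcomp Require Import all_boot all_order all_algebra.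
From mathcomp Require Import all_classical all_reals all_analysis.

Set Implicit Arguments.
Unset Strict Implicit.
Unset Printing Implicit Defensive.

Import Order.TTheory GRing.Theory Num.Theory.
Import numFieldNormedType.Exports.

Local Open Scope classical_set_scope.
Local Open Scope ring_scope.

(* The matrices (A, N_1, ..., N_q, X_0, C) of a system with state dimension n.
   Both the full order (dimension n) and the reduced order (dimension nh)
   matrices are terms of this type. *)
Record model (R : realType) (q m p n : nat) := Model {
  mA : 'M[R]_n;
  mN : 'I_q -> 'M[R]_n;
  mX0 : 'M[R]_(n, m);
  mC : 'M[R]_(p, n)
}.

(* K is symmetric positive semidefinite, i.e., the covariance matrix (at time
   1) of some square integrable mean-zero Levy process with values in R^q. *)
Definition covariance_matrix (R : realType) (q : nat) (K : 'M[R]_q) : Prop :=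
  K^T = K /\ forall v : 'cV[R]_q, 0 <= (v^T *m K *m v) 0 0.

Section Operators.
Variables (R : realType) (q m p : nat) (K : 'M[R]_q).

(* lyap K s r is X |-> A_s X + X A_r^T + sum_{i,j} N_{s,i} X N_{r,j}^T k_ij.
   With s the full and r the reduced matrices, lyap K s s, lyap K r r and
   lyap K s r are the operators L, L^hat and L^tilde. *)
Definition lyap (a b : nat) (s : model R q m p a) (r : model R q m p b)
    (X : 'M[R]_(a, b)) : 'M[R]_(a, b) :=
  mA s *m X + X *m (mA r)^T
  + \sum_(i < q) \sum_(j < q) K i j *: (mN s i *m X *m (mN r j)^T).

Definition lyap_adj (a b : nat) (s : model R q m p a) (r : model R q m p b)
    (X : 'M[R]_(a, b)) : 'M[R]_(a, b) :=
  (mA s)^T *m X + X *m mA r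
  + \sum_(i < q) \sum_(j < q) K i j *: ((mN s i)^T *m X *m mN r j).

Lemma lyap_linear (a b : nat) (s : model R q m p a) (r : model R q m p b) :
  linear (lyap s r).
Proof.
move=> c X Y; rewrite /lyap mulmxDr mulmxDl -scalemxAr -scalemxAl.
rewrite !scalerDr addrACA [RHS]addrACA; congr (_ + _).
rewrite scaler_sumr -big_split; apply: eq_bigr => i _ /=.
rewrite scaler_sumr -big_split; apply: eq_bigr => j _ /=.
by rewrite mulmxDr mulmxDl -scalemxAr -scalemxAl scalerDr !scalerA mulrC.
Qed.

Lemma lyap_adj_linear (a b : nat) (s : model R q m p a) (r : model R q m p b) :
  linear (lyap_adj s r).
Proof.
move=> c X Y; rewrite /lyap_adj mulmxDr mulmxDl -scalemxAr -scalemxAl.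
rewrite !scalerDr addrACA [RHS]addrACA; congr (_ + _).
rewrite scaler_sumr -big_split; apply: eq_bigr => i _ /=.
rewrite scaler_sumr -big_split; apply: eq_bigr => j _ /=.
by rewrite mulmxDr mulmxDl -scalemxAr -scalemxAl scalerDr !scalerA mulrC.
Qed.

(* The operators are adjoint for the Frobenius product <X, Y> = tr (X^T Y). *)
Lemma lyap_adjE (a b : nat) (s : model R q m p a) (r : model R q m p b)
    (X Y : 'M[R]_(a, b)) :
  \tr ((lyap s r X)^T *m Y) = \tr (X^T *m lyap_adj s r Y).
Proof.
rewrite /lyap /lyap_adj [(_ + _ + _)^T]linearD /= [(_ + _)^T]linearD /=.
rewrite mulmxDl mulmxDl mulmxDr mulmxDr !mxtraceD.
congr (_ + _ + _).
- by rewrite trmx_mul mulmxA.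
- by rewrite trmx_mul trmxK -mulmxA mxtrace_mulC mulmxA.
rewrite linear_sum /= mulmx_suml mulmx_sumr !linear_sum /=.
apply: eq_bigr => i _.
rewrite linear_sum /= mulmx_suml mulmx_sumr !linear_sum /=.
apply: eq_bigr => j _.
rewrite linearZ /= -scalemxAl -scalemxAr !mxtraceZ; congr (_ * _).
by rewrite !trmx_mul trmxK -!mulmxA mxtrace_mulC !mulmxA.
Qed.

End Operators.

(* Total; by op_invK it is the inverse of every bijective linear f. *)
Definition op_inv (R : realType) (a b : nat) (f : 'M[R]_(a, b) -> 'M[R]_(a, b))
    : 'M[R]_(a, b) -> 'M[R]_(a, b) :=
  ((linfun f)^-1)%VF.

Lemma op_invK (R : realType) (a b : nat) (f : 'M[R]_(a, b) -> 'M[R]_(a, b)) :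
  linear f -> bijective f -> cancel f (op_inv f) /\ cancel (op_inv f) f.
Proof.
move=> lf bf.
pose mlf := GRing.isLinear.Build _ _ _ _ f lf.
pose ff : {linear 'M[R]_(a, b) -> 'M[R]_(a, b)} := HB.pack f mlf.
have fE : linfun f =1 f by move=> X; exact: (lfunE ff).
have K0 : lker (linfun f) == 0%VS.
  by apply/lker0P => X Y; rewrite !fE; exact: (bij_inj bf).
have fK : cancel f (op_inv f).
  by move=> X; rewrite /op_inv -{1}fE lker0_lfunK.
split=> //; case: bf => g _ gK X.
by rewrite -[X]gK fK.
Qed.

(* Solutions on [0, T] of dF/dt = f(F), F(0) = F0. The values of F outside
   [0, T] are irrelevant. *)
Definition ode_solution (R : realType) (a b : nat) (T : R)
    (f : 'M[R]_(a, b) -> 'M[R]_(a, b)) (F0 : 'M[R]_(a, b))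
    (F : R -> 'M[R]_(a, b)) : Prop :=
  [/\ F 0 = F0,
      {within `[0, T], continuous F}
    & forall t : R, 0 < t < T -> is_derive t (1 : R) F (f (F t))].

Definition mx_integral (R : realType) (a b : nat) (T : R)
    (F : R -> 'M[R]_(a, b)) : 'M[R]_(a, b) :=
  \matrix_(i, j) (\int[@lebesgue_measure R]_(t in `[0, T]) F t i j).

(* Expectation of F under the probability measure dt / T on [0, T]. *)
Definition time_average (R : realType) (a b : nat) (T : R)
    (F : R -> 'M[R]_(a, b)) : 'M[R]_(a, b) :=
  T^-1 *: mx_integral T F.

Definition opnorm (R : realType) (a b c d : nat)
    (f : 'M[R]_(a, b) -> 'M[R]_(c, d)) : R :=
  sup [set `|f Z| | Z in [set Z : 'M[R]_(a, b) | `|Z| <= 1]].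

Section SylvesterIteration.
Variables (R : realType) (q m p n nh : nat) (K : 'M[R]_q) (T : R).
Variable s : model R q m p n.

(* F^hat and F^tilde are the cases s = r and s full, r reduced. *)
Definition state_cov (a b : nat) (s : model R q m p a) (r : model R q m p b) :=
  ode_solution T (lyap K s r) (mX0 s *m (mX0 r)^T).

Definition output_cov (a b : nat) (s : model R q m p a) (r : model R q m p b) :=
  ode_solution T (lyap_adj K s r) ((mC s)^T *m mC r).

Definition change_basis (S : 'M[R]_nh) (r : model R q m p nh) :
    model R q m p nh :=
  Model (S *m mA r *m invmx S) (fun i => S *m mN r i *m invmx S)
        (S *m mX0 r) (mC r *m invmx S).

(* The columns of V are an orthonormal basis of the column space of M; the
   transposes are there because %MS compares row spaces. *)
Definition orthonormal_basis_im (M V : 'M[R]_(n, nh)) : Prop :=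
  V^T *m V = 1%:M /\ (V^T == M^T)%MS.

Definition petrov_galerkin (V W : 'M[R]_(n, nh)) : model R q m p nh :=
  let P := invmx (W^T *m V) *m W^T in
  Model (P *m mA s *m V) (fun i => P *m mN s i *m V) (P *m mX0 s) (mC s *m V).

Variable S : model R q m p nh -> 'M[R]_nh.

Definition sylvester_step (r : model R q m p nh) (V W : 'M[R]_(n, nh))
    (r' : model R q m p nh) : Prop :=
  S r \in unitmx /\
  exists X Y : R -> 'M[R]_(n, nh),
    [/\ state_cov s (change_basis (S r) r) X,
        output_cov s (change_basis (S r) r) Y,
        orthonormal_basis_im (mx_integral T X) V,
        orthonormal_basis_im (mx_integral T Y) W
      & W^T *m V \in unitmx /\ r' = petrov_galerkin V W].

Inductive sylvester_iterate (r0 : model R q m p nh) :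
    model R q m p nh -> Prop :=
| sylvester_start : sylvester_iterate r0 r0
| sylvester_next r V W r' :
    sylvester_iterate r0 r -> sylvester_step r V W r' ->
    sylvester_iterate r0 r'.

Definition sylvester_converged (r0 r : model R q m p nh)
    (V W : 'M[R]_(n, nh)) : Prop :=
  sylvester_iterate r0 r /\ sylvester_step r V W r.

End SylvesterIteration.

(* Main.v *)
Require Import Defs.
From HB Require Import structures.
From mathcomp Require Import all_boot all_order all_algebra.
From mathcomp Require Import all_classical all_reals all_analysis.
From mathcomp Require Import ring.

(** The two identities are one statement about Galerkin projections, used twice.

Let Lt and Lh be linear operators on full-by-reduced and on reduced matrices,
let V have the left inverse P, and suppose that P Lt(V Z) = Lh(Z) for all Z.
Let Ft and Fh solve the linear ODEs of Lt and Lh, the second one started at the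
projection P Ft(0) of the first initial value.  Integrating the ODEs gives
Lt(int Ft) = Ft(T) - Ft(0) and Lh(int Fh) = Fh(T) - P Ft(0)
([ode_solution_integral]).  If moreover the columns of int Ft lie in the range
of V, so that int Ft = V Z with Z = P int Ft, then projecting the first
equation gives Lh(Z) = P Ft(T) - P Ft(0), hence
Lh(int Fh - Z) = Fh(T) - P Ft(T).  Inverting Lh and multiplying by V gives the
error formula, and since Fh(T) - P Ft(T) = P (V Fh(T) - Ft(T)), taking norms
bounds the averaged error by the terminal one ([galerkin_error]).

At a fixed point of the iteration the reduced matrices are the
Petrov-Galerkin projections of the full ones, which provides the compatibility
P Lt(V Z) = Lh(Z): for (i) with V and P = (W^T V)^-1 W^T, for (ii) with
W (V^T W)^-1 in the role of V and V^T in the role of P.  The range condition is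
what the iteration enforces.  V and W span the images of the integrals of X
and Y, which solve the Sylvester equations of a reduced model in other
coordinates.  The change of coordinates S turns the solutions Ft, Gt for the
fixed point itself into solutions Ft S^T, Gt S^-1 of those equations
([lyap_mulr], [lyap_adj_mulr]), so by uniqueness of solutions
([ode_solution_uniq]) X = Ft S^T and Y = Gt S^-1, and an invertible factor on
the right leaves the image of the integral unchanged ([ode_solution_mulr_im]).
*)

Set Implicit Arguments.
Unset Strict Implicit.
Unset Printing Implicit Defensive.

Import Order.TTheory GRing.Theory Num.Theory.
Import numFieldNormedType.Exports.

Local Open Scope classical_set_scope.
Local Open Scope ring_scope.

(** * Linear maps on matrices and calculus of matrix-valued functions *)

Lemma coord_le_mx_norm (R : realType) (a b : nat) (Z : 'M[R]_(a, b)) i j :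
  `|Z i j| <= `|Z|.
Proof.
by rewrite [leRHS]/Num.Def.normr /= mx_normrE; apply: (le_bigmax _ _ (i, j)).
Qed.

Lemma linear_mx_sum (R : realType) (a b : nat) (W : lmodType R)
    (h : {linear 'M[R]_(a, b) -> W}) Z :
  h Z = \sum_i \sum_j Z i j *: h (delta_mx i j).
Proof.
rewrite {1}[Z]matrix_sum_delta linear_sum; apply: eq_bigr => i _.
by rewrite linear_sum; apply: eq_bigr => j _; rewrite linearZ.
Qed.

Lemma linear_mx_bounded (R : realType) (a b : nat) (W : normedModType R)
    (h : {linear 'M[R]_(a, b) -> W}) :
  exists2 c, 0 <= c & forall Z, `|h Z| <= c * `|Z|.
Proof.
exists (\sum_i \sum_j `|h (delta_mx i j)|) => [|Z].
  by apply: sumr_ge0 => i _; apply: sumr_ge0.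
rewrite linear_mx_sum (le_trans (ler_norm_sum _ _ _))// mulr_suml.
apply: ler_sum => i _; rewrite (le_trans (ler_norm_sum _ _ _))// mulr_suml.
apply: ler_sum => j _; rewrite normrZ mulrC.
by apply: ler_wpM2l => //; exact: coord_le_mx_norm.
Qed.

Lemma linear_mx_continuous (R : realType) (a b : nat) (W : normedModType R)
    (h : {linear 'M[R]_(a, b) -> W}) : continuous h.
Proof.
apply/linear_bounded_continuous/linear_boundedP.
have [c c0 hc] := linear_mx_bounded h.
near=> k => Z; rewrite (le_trans (hc Z))// ler_wpM2r//.
Unshelve. all: by end_near. Qed.

Lemma continuous_within_linear (R : realType) (a b : nat)
    (W : normedModType R) (h : {linear 'M[R]_(a, b) -> W}) (A : set R)
    (F : R -> 'M[R]_(a, b)) :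
  {within A, continuous F} -> {within A, continuous (h \o F)}.
Proof.
move=> cF x; apply: (@continuous_comp _ _ _ (F : subspace A -> _) h x).
  exact: cF.
exact: linear_mx_continuous.
Qed.

Lemma is_derive_linear (R : realType) (a b : nat) (W : normedModType R)
    (h : {linear 'M[R]_(a, b) -> W}) (F : R -> 'M[R]_(a, b)) t D :
  is_derive t (1 : R) F D -> is_derive t (1 : R) (h \o F) (h D).
Proof.
move=> dF; have ch := @linear_mx_continuous R a b W h.
have diffF : differentiable F t by apply/derivable1_diffP; exact: ex_derive.
have diffh := linear_differentiable (F t) ch.
apply: DeriveDef.
  by apply/derivable1_diffP; exact: differentiable_comp.
rewrite deriveE; last exact: differentiable_comp.
by rewrite diff_comp// diff_lin//= -deriveE// derive_val.
Qed.

(** An entry of a matrix as a linear map into the normed space R^o, which makes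
    the lemmas on composition with linear maps apply entrywise. *)
Definition coord_mx (R : realType) (a b : nat) (i : 'I_a) (j : 'I_b)
  (Z : 'M[R]_(a, b)) : R := Z i j.

Lemma coord_mx_linear (R : realType) (a b : nat) (i : 'I_a) (j : 'I_b) :
  linear (@coord_mx R a b i j : 'M[R]_(a, b) -> R^o).
Proof. by move=> c X Y; rewrite /coord_mx !mxE. Qed.

HB.instance Definition _ (R : realType) (a b : nat) (i : 'I_a) (j : 'I_b) :=
  GRing.isLinear.Build R 'M[R]_(a, b) R^o _ (@coord_mx R a b i j)
    (@coord_mx_linear R a b i j).

Lemma continuous_within_coord (R : realType) (a b : nat) (A : set R)
    (F : R -> 'M[R]_(a, b)) i j :
  {within A, continuous F} -> {within A, continuous (fun t => F t i j)}.
Proof.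
exact: (@continuous_within_linear R a b R^o (coord_mx i j)).
Qed.

Lemma is_derive_coord (R : realType) (a b : nat) (F : R -> 'M[R]_(a, b)) t D
    i j :
  is_derive t (1 : R) F D -> is_derive t (1 : R) (fun t => F t i j) (D i j).
Proof. exact: (@is_derive_linear R a b R^o (coord_mx i j)). Qed.

Lemma integrable_coord (R : realType) (a b : nat) (T : R)
    (F : R -> 'M[R]_(a, b)) i j :
  {within `[0, T], continuous F} ->
  (@lebesgue_measure R).-integrable `[0, T] (EFin \o (fun t => F t i j)).
Proof.
move=> cF; apply: continuous_compact_integrable; first exact: segment_compact.
exact: continuous_within_coord.
Qed.

Lemma Rintegral_sum (d : measure_display) (T : measurableType d)
    (R : realType) (mu : {measure set T -> \bar R}) (D : set T) (I : Type)
    (s : seq I) (f : I -> T -> R) :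
  measurable D -> (forall i, mu.-integrable D (EFin \o f i)) ->
  \int[mu]_(x in D) (\sum_(i <- s) f i x) =
  \sum_(i <- s) \int[mu]_(x in D) f i x.
Proof.
move=> mD fint; rewrite /Rintegral.
under eq_integral do rewrite -sumEFin.
rewrite (@integral_sum _ _ _ _ _ mD _ (fun i => EFin \o f i))//.
rewrite -sum_fine// => i _; apply: integrable_fin_num => //; exact: fint.
Qed.

(** Every entry of [h (F t)] is a fixed linear combination of the entries of
    [F t], so this is linearity of the scalar integral. *)
Lemma mx_integral_linear (R : realType) (a b c d : nat) (T : R)
    (h : {linear 'M[R]_(a, b) -> 'M[R]_(c, d)}) (F : R -> 'M[R]_(a, b)) :
  {within `[0, T], continuous F} ->
  mx_integral T (h \o F) = h (mx_integral T F).
Proof.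
move=> cF; apply/matrixP => k l; rewrite mxE.
have hE Z : h Z k l =
    \sum_(p : 'I_a * 'I_b) h (delta_mx p.1 p.2) k l * Z p.1 p.2.
  rewrite linear_mx_sum summxE; under eq_bigr do rewrite summxE.
  rewrite pair_bigA /=; apply: eq_bigr => -[i j] _.
  by rewrite mxE mulrC.
under eq_Rintegral do rewrite /= hE.
have intF (p : 'I_a * 'I_b) := integrable_coord p.1 p.2 cF.
rewrite Rintegral_sum//; last first.
  by move=> p; apply: (integrableZl _ _ (intF p)).
rewrite hE; apply: eq_bigr => p _; rewrite mxE RintegralZl//; exact: intF.
Qed.

Lemma mx_integralB (R : realType) (a b : nat) (T : R)
    (F G : R -> 'M[R]_(a, b)) :
  {within `[0, T], continuous F} -> {within `[0, T], continuous G} ->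
  mx_integral T (fun t => F t - G t) = mx_integral T F - mx_integral T G.
Proof.
move=> cF cG; apply/matrixP => i j; rewrite !mxE -RintegralB//.
- by apply: eq_Rintegral => t _; rewrite !mxE.
- exact: integrable_coord.
- exact: integrable_coord.
Qed.

Lemma eq_mx_integral (R : realType) (a b : nat) (T : R)
    (F G : R -> 'M[R]_(a, b)) :
  {in `[0, T], F =1 G} -> mx_integral T F = mx_integral T G.
Proof.
move=> FG; apply/matrixP => i j; rewrite !mxE.
by apply: eq_Rintegral => t tT; rewrite FG// -inE.
Qed.

(** * Linear matrix differential equations *)

(** A linear map intertwining two vector fields carries solutions of the one to
    solutions of the other; below, this expresses a change of coordinates. *)
Lemma ode_solution_map (R : realType) (a b c d : nat) (T : R)
    (f : 'M[R]_(a, b) -> 'M[R]_(a, b)) (g : 'M[R]_(c, d) -> 'M[R]_(c, d))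
    (h : {linear 'M[R]_(a, b) -> 'M[R]_(c, d)}) F0 F :
  (forall Z, h (f Z) = g (h Z)) ->
  ode_solution T f F0 F -> ode_solution T g (h F0) (h \o F).
Proof.
move=> hfg [F0E cF dF]; split.
- by rewrite /= F0E.
- exact: continuous_within_linear.
- by move=> t tT; rewrite /= -hfg; exact/is_derive_linear/dF.
Qed.

(** The fundamental theorem of calculus, applied to the ODE itself. *)
Lemma ode_solution_integral (R : realType) (a b : nat) (T : R)
    (f : {linear 'M[R]_(a, b) -> 'M[R]_(a, b)}) F0 F :
  0 < T -> ode_solution T f F0 F -> f (mx_integral T F) = F T - F0.
Proof.
move=> T0 [F0E cF dF]; rewrite -mx_integral_linear//.
apply/matrixP => i j; rewrite !mxE /Rintegral.
have cFij := continuous_within_coord (i := i) (j := j) cF.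
have dFij t : t \in `]0, T[ ->
    is_derive t (1 : R) (fun t => F t i j) (f (F t) i j).
  by rewrite in_itv/= => tT; exact/is_derive_coord/dF.
rewrite (@continuous_FTC2 _ _ (fun t => F t i j))//.
- by rewrite F0E.
- exact/continuous_within_coord/continuous_within_linear.
- move/continuous_within_itvP: cFij => /(_ T0)[_ F0r FTl].
  by split=> // t /dFij dFt; exact: ex_derive.
- by move=> t /dFij dFt; rewrite derive1E derive_val.
Qed.

(** The squared Frobenius norm: unlike the norm of the matrix space, the maximum
    of the entries, it can be differentiated along a curve. *)
Definition sqr_frobenius (R : realType) (a b : nat) (Z : 'M[R]_(a, b)) : R :=
  \sum_i \sum_j Z i j * Z i j.

Lemma sqr_mx_norm_le_frobenius (R : realType) (a b : nat) (Z : 'M[R]_(a, b)) :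
  `|Z| ^+ 2 <= sqr_frobenius Z.
Proof.
have [->|Z0] := eqVneq Z 0.
  rewrite normr0 expr0n /sqr_frobenius/=; apply: sumr_ge0 => i _.
  by apply: sumr_ge0 => j _; rewrite -expr2 sqr_ge0.
have /mx_norm_neq0[[i j] /= nZ] : mx_norm Z != 0.
  by rewrite -[mx_norm _]/(`|Z|) normr_eq0.
rewrite (nZ : `|Z| = _) real_normK ?num_real// /sqr_frobenius.
rewrite (bigD1 i)//= (bigD1 j)//= -addrA -expr2 lerDl.
by rewrite addr_ge0// sumr_ge0// => k _; rewrite ?sumr_ge0// => *;
  rewrite -expr2 sqr_ge0.
Qed.

Lemma sqr_frobenius_continuous (R : realType) (a b : nat) :
  continuous (@sqr_frobenius R a b).
Proof.
apply: continuous_big => [|i _]; first exact: add_continuous.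
apply: continuous_big => [|j _]; first exact: add_continuous.
by move=> Z; apply: continuousM; exact: coord_continuous.
Qed.

(** Gronwall's argument: the squared Frobenius norm [e] of the difference of the
    two solutions satisfies e' <= C e with e(0) = 0, so e(t) exp(- C t) is
    nonincreasing and e vanishes. *)
Lemma ode_solution_uniq (R : realType) (a b : nat) (T : R)
    (f : {linear 'M[R]_(a, b) -> 'M[R]_(a, b)}) F0 F G :
  0 < T -> ode_solution T f F0 F -> ode_solution T f F0 G ->
  {in `[0, T], F =1 G}.
Proof.
move=> T0 [F0E cF dF] [G0E cG dG].
pose Z t := F t - G t.
have cZ : {within `[0, T], continuous Z}.
  by move=> t; apply: continuousB; [exact: cF|exact: cG].
have dZ t : t \in `]0, T[ -> is_derive t (1 : R) Z (f (Z t)).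
  rewrite in_itv/= => tT; rewrite linearB.
  by apply: is_deriveB; [exact: dF|exact: dG].
have [c c0 fc] := linear_mx_bounded f.
(* Each of the a * b summands 2 Z_ij f(Z)_ij of e' is at most 2 c |Z|^2. *)
pose C := (a * b)%:R * (2 * c).
pose e t := sqr_frobenius (Z t).
pose de t := \sum_i \sum_j 2 * (Z t i j * f (Z t) i j).
have de_le t : de t <= C * e t.
  apply: (@le_trans _ _ (C * `|Z t| ^+ 2)); last first.
    by rewrite ler_wpM2l ?sqr_mx_norm_le_frobenius// !mulr_ge0.
  apply: (@le_trans _ _ (\sum_(i < a) \sum_(j < b) 2 * c * `|Z t| ^+ 2)).
    apply: ler_sum => i _; apply: ler_sum => j _.
    rewrite -mulrA ler_wpM2l// (le_trans (ler_norm _))// normrM expr2 mulrCA.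
    by rewrite ler_pM ?coord_le_mx_norm// (le_trans (coord_le_mx_norm _ _ _)).
  by rewrite !sumr_const !card_ord -mulrnA mulnC -[leLHS]mulr_natl /C !mulrA.
have d_e t : t \in `]0, T[ -> is_derive t (1 : R) e (de t).
  move=> tT.
  have -> : e = \sum_i \sum_j ((fun t => Z t i j) * (fun t => Z t i j)).
    apply/funext => u; rewrite fct_sumE; apply: eq_bigr => i _.
    by rewrite fct_sumE.
  apply: is_derive_sum => i; apply: is_derive_sum => j.
  have dZij := is_derive_coord i j (dZ t tT).
  apply: is_derive_eq; by rewrite mulr_natl mulr2n.
have c_e : {within `[0, T], continuous e}.
  move=> t; apply: (@continuous_comp _ _ _ (Z : subspace `[0, T] -> _) _ t).
    exact: cZ.
  exact: sqr_frobenius_continuous.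
pose u t := e t * expR (- C * t).
have du t : t \in `]0, T[ ->
    is_derive t (1 : R) u ((de t - C * e t) * expR (- C * t)).
  move=> /d_e det; rewrite /u.
  have dexp : is_derive t (1 : R) (fun t => expR (- C * t))
      (expR (- C * t) * - C).
    have dC : is_derive t (1 : R) (fun t => - C * t) (- C).
      by apply: is_derive_eq; rewrite /GRing.scale/= mulr1.
    exact: (@is_derive1_comp _ expR (fun t => - C * t)).
  apply: is_derive_eq; rewrite /GRing.scale/=; ring.
have c_u : {within `[0, T], continuous u}.
  move=> t; apply: continuousM; first exact: c_e.
  apply: continuous_subspaceT => x; apply: continuous_comp.
    exact: mulrl_continuous.
  exact: continuous_expR.
have u_le t : t \in `[0, T] -> u t <= u 0.
  move=> tT; have := tT; rewrite in_itv/= => /andP[t0 _].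
  apply: (@ler0_derive1_le_cc _ u 0 T) => //.
  - by move=> s /du dus; exact: ex_derive.
  - move=> s /du dus; rewrite derive1E derive_val.
    by rewrite mulr_le0_ge0 ?expR_ge0// subr_le0.
  - by rewrite in_itv/= lexx ltW.
have u0 : u 0 = 0.
  rewrite /u /e /Z F0E G0E subrr /sqr_frobenius big1 ?mul0r// => i _.
  by rewrite big1// => j _; rewrite mxE mul0r.
move=> t /u_le; rewrite u0 /u pmulr_lle0 ?expR_gt0// => et.
apply/eqP; rewrite -subr_eq0 -normr_eq0 -sqrf_eq0 eq_le sqr_ge0 andbT.
exact: le_trans (sqr_mx_norm_le_frobenius _) et.
Qed.

(** * Operator norm and inverse of linear operators *)

(** In finite dimension the supremum defining [opnorm] is taken over a bounded
    set, so it does dominate the value at the normalized matrix Z / |Z|. *)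
Lemma opnorm_bound (R : realType) (a b c d : nat)
    (g : {linear 'M[R]_(a, b) -> 'M[R]_(c, d)}) Z :
  `|g Z| <= opnorm g * `|Z|.
Proof.
have [k k0 gk] := linear_mx_bounded g.
have ub : has_ubound [set `|g Z| | Z in [set Z : 'M[R]_(a, b) | `|Z| <= 1]].
  exists k => _ [Y /= Y1 <-].
  by rewrite (le_trans (gk Y))// -[leRHS]mulr1 ler_wpM2l.
have [->|Z0] := eqVneq Z 0; first by rewrite linear0 !normr0 mulr0.
rewrite -ler_pdivrMr ?normr_gt0//; apply: ub_le_sup => //=.
exists (`|Z|^-1 *: Z).
  by rewrite /= normrZ ger0_norm ?invr_ge0// mulVf ?normr_eq0.
by rewrite linearZ /= normrZ ger0_norm ?invr_ge0// mulrC.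
Qed.

HB.instance Definition _ (R : realType) (q m p : nat) (K : 'M[R]_q)
    (a b : nat) (s : model R q m p a) (r : model R q m p b) :=
  GRing.isLinear.Build R 'M[R]_(a, b) 'M[R]_(a, b) _ (lyap K s r)
    (@lyap_linear R q m p K a b s r).

HB.instance Definition _ (R : realType) (q m p : nat) (K : 'M[R]_q)
    (a b : nat) (s : model R q m p a) (r : model R q m p b) :=
  GRing.isLinear.Build R 'M[R]_(a, b) 'M[R]_(a, b) _ (lyap_adj K s r)
    (@lyap_adj_linear R q m p K a b s r).

Lemma op_inv_linear (R : realType) (a b : nat)
    (f : 'M[R]_(a, b) -> 'M[R]_(a, b)) : linear (op_inv f).
Proof. by move=> c X Y; rewrite /op_inv linearP. Qed.

HB.instance Definition _ (R : realType) (a b : nat)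
    (f : 'M[R]_(a, b) -> 'M[R]_(a, b)) :=
  GRing.isLinear.Build R 'M[R]_(a, b) 'M[R]_(a, b) _ (op_inv f)
    (@op_inv_linear R a b f).

Lemma op_inv_injK (R : realType) (a b : nat)
    (f : {linear 'M[R]_(a, b) -> 'M[R]_(a, b)}) :
  injective f -> cancel f (op_inv f).
Proof.
move=> fI X; have fE := lfunE f.
rewrite /op_inv -{1}fE lker0_lfunK//.
by apply/lker0P => Y Z; rewrite !fE; exact: fI.
Qed.

(** The kernel of the adjoint is orthogonal to the range of [lyap K s r]; when
    that range is everything, testing against the matrix units [delta_mx i j]
    shows that the kernel is trivial. *)
Lemma lyap_adj_inj (R : realType) (q m p : nat) (K : 'M[R]_q) (a b : nat)
    (s : model R q m p a) (r : model R q m p b) :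
  bijective (lyap K s r) -> injective (lyap_adj K s r).
Proof.
move=> [g _ gK]; apply: raddf_inj => Y LY0.
apply/matrixP => i j; rewrite mxE.
have := lyap_adjE K s r (g (delta_mx i j)) Y.
rewrite gK LY0 mulmx0 mxtrace0 trmx_delta /mxtrace => <-.
rewrite (bigD1 j)//= big1 ?addr0 => [|k kj].
  rewrite mxE (bigD1 i)//= big1 ?addr0 => [|k ki]; rewrite mxE ?eqxx ?mul1r//.
  by rewrite (negPf ki) andbF mul0r.
by rewrite mxE big1// => l _; rewrite mxE (negPf kj) mul0r.
Qed.

(** * Error of a Galerkin projection *)

(** The common content of (i) and (ii), where [V] and [P] are the two factors of
    the projection and [Lt], [Lh] the full and reduced operators.  The last
    hypothesis says that the columns of the integral of [Ft] lie in the range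
    of [V]. *)
Lemma galerkin_error (R : realType) (n nh : nat) (T : R)
    (Lt : {linear 'M[R]_(n, nh) -> 'M[R]_(n, nh)})
    (Lh : {linear 'M[R]_nh -> 'M[R]_nh})
    (V : 'M[R]_(n, nh)) (P : 'M[R]_(nh, n)) Ft0 Ft Fh :
  0 < T -> P *m V = 1%:M -> injective Lh ->
  (forall Z, P *m Lt (V *m Z) = Lh Z) ->
  ode_solution T Lh (P *m Ft0) Fh -> ode_solution T Lt Ft0 Ft ->
  V *m (P *m mx_integral T Ft) = mx_integral T Ft ->
  V *m mx_integral T Fh - mx_integral T Ft
    = V *m op_inv Lh (Fh T - P *m Ft T) /\
  `|time_average T (fun t => V *m Fh t - Ft t)|
    <= T^-1 * opnorm (fun Z => V *m op_inv Lh (P *m Z)) * `|V *m Fh T - Ft T|.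
Proof.
move=> T0 PV LhI PLt solh solt VPt.
have err : V *m mx_integral T Fh - mx_integral T Ft
    = V *m op_inv Lh (Fh T - P *m Ft T).
  rewrite -{1}VPt -mulmxBr; congr (_ *m _); rewrite -[LHS](op_inv_injK LhI).
  congr (op_inv _ _); rewrite linearB /= (ode_solution_integral T0 solh).
  rewrite -PLt VPt (ode_solution_integral T0 solt) mulmxBr.
  by rewrite opprB addrA subrK.
split=> //.
have [[_ ch _] [_ ct _]] := (solh, solt).
rewrite /time_average mx_integralB//; last first.
  exact: (continuous_within_linear (h := mulmx V)).
rewrite (mx_integral_linear (mulmx V))// err normrZ.
have T'0 : 0 <= T^-1 by rewrite invr_ge0 ltW.
rewrite ger0_norm// -mulrA ler_wpM2l//.
have -> : Fh T - P *m Ft T = P *m (V *m Fh T - Ft T).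
  by rewrite mulmxBr mulmxA PV mul1mx.
exact: (opnorm_bound (mulmx V \o op_inv Lh \o mulmx P)).
Qed.

(** * Range of the integrals at a fixed point of the iteration *)

(** Only the reduced side is expressed in new coordinates, so a change of basis
    of the reduced model acts on the mixed operator by a multiplication on the
    right; the factor is U^T for states, and U^-1 for the adjoint operator. *)
Lemma lyap_mulr (R : realType) (q m p : nat) (K : 'M[R]_q) (n nh : nat)
    (s : model R q m p n) (r : model R q m p nh) (U : 'M[R]_nh) Z :
  U \in unitmx ->
  lyap K s r Z *m U^T = lyap K s (change_basis U r) (Z *m U^T).
Proof.
move=> uU.
have conjE (B : 'M[R]_nh) : Z *m U^T *m (U *m B *m invmx U)^T = Z *m B^T *m U^T.
  by rewrite !trmx_mul !mulmxA -(mulmxA Z) -trmx_mul mulVmx// trmx1 mulmx1.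
rewrite /lyap !mulmxDl /= conjE mulmxA; congr (_ + _).
rewrite mulmx_suml; apply: eq_bigr => i _; rewrite mulmx_suml.
apply: eq_bigr => j _; rewrite -scalemxAl; congr (_ *: _).
by rewrite -!mulmxA; congr (_ *m _); rewrite !mulmxA conjE.
Qed.

Lemma lyap_adj_mulr (R : realType) (q m p : nat) (K : 'M[R]_q) (n nh : nat)
    (s : model R q m p n) (r : model R q m p nh) (U : 'M[R]_nh) Z :
  U \in unitmx ->
  lyap_adj K s r Z *m invmx U
    = lyap_adj K s (change_basis U r) (Z *m invmx U).
Proof.
move=> uU.
have conjE (B : 'M[R]_nh) : Z *m invmx U *m (U *m B *m invmx U)
    = Z *m B *m invmx U.
  by rewrite !mulmxA mulmxKV.
rewrite /lyap_adj !mulmxDl /= conjE mulmxA; congr (_ + _).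
rewrite mulmx_suml; apply: eq_bigr => i _; rewrite mulmx_suml.
apply: eq_bigr => j _; rewrite -scalemxAl; congr (_ *: _).
by rewrite -!mulmxA; congr (_ *m _); rewrite !mulmxA mulmxKV.
Qed.

(** By uniqueness [X] is [F] times the invertible [U], so both integrals have
    the same image.  Row spaces of transposes stand for column spaces. *)
Lemma ode_solution_mulr_im (R : realType) (n nh : nat) (T : R)
    (f g : {linear 'M[R]_(n, nh) -> 'M[R]_(n, nh)}) (U : 'M[R]_nh)
    F0 F X (V : 'M[R]_(n, nh)) :
  0 < T -> U \in unitmx -> (forall Z, f Z *m U = g (Z *m U)) ->
  ode_solution T f F0 F -> ode_solution T g (F0 *m U) X ->
  (V^T == (mx_integral T X)^T)%MS ->
  exists D, mx_integral T F = V *m D.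
Proof.
move=> T0 uU fg solF solX /andP[_ XV].
have solFU := ode_solution_map (h := @mulmxr R n nh nh U) fg solF.
have intX : mx_integral T X = mx_integral T F *m U.
  rewrite (eq_mx_integral (ode_solution_uniq T0 solX solFU)).
  by case: solF => _ cF _; rewrite (mx_integral_linear (@mulmxr R n nh nh U)).
have /submxP[D FD] : ((mx_integral T F)^T <= V^T)%MS.
  apply: submx_trans XV.
  by rewrite -[mx_integral T F](mulmxK uU) -intX trmx_mul submxMl.
by exists D^T; apply: trmx_inj; rewrite trmx_mul trmxK.
Qed.

(** * Errors at a fixed point *)

Theorem theorem3p3 (R : realType) (q m p n nh : nat)
    (K : 'M[R]_q) (T : R) (s : model R q m p n)
    (S : model R q m p nh -> 'M[R]_nh) (r0 r : model R q m p nh)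
    (V W : 'M[R]_(n, nh))
    (Fh : R -> 'M[R]_nh) (Ft : R -> 'M[R]_(n, nh))
    (Gh : R -> 'M[R]_nh) (Gt : R -> 'M[R]_(n, nh)) :
  covariance_matrix K ->
  0 < T ->
  sylvester_converged K T s S r0 r V W ->
  bijective (lyap K s s) ->
  bijective (lyap K r r) ->
  state_cov K T r r Fh ->
  state_cov K T s r Ft ->
  output_cov K T r r Gh ->
  output_cov K T s r Gt ->
  let Ph := mx_integral T Fh in
  let Pt := mx_integral T Ft in
  let Qh := mx_integral T Gh in
  let Qt := mx_integral T Gt in
  let Lh_inv := op_inv (lyap K r r) in
  let Lh_adj_inv := op_inv (lyap_adj K r r) in
  let W' := W *m invmx (V^T *m W) in
  (* (i) and (ii) *)
  V *m Ph - Pt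
    = V *m Lh_inv (Fh T - invmx (W^T *m V) *m W^T *m Ft T) /\
  W' *m Qh - Qt = W' *m Lh_adj_inv (Gh T - V^T *m Gt T) /\
  (* the errors on average with respect to dt / T are controlled by the errors
     at the terminal time T *)
  `|time_average T (fun t => V *m Fh t - Ft t)|
    <= T^-1 * opnorm (fun Z => V *m Lh_inv (invmx (W^T *m V) *m W^T *m Z))
       * `|V *m Fh T - Ft T| /\
  `|time_average T (fun t => W' *m Gh t - Gt t)|
    <= T^-1 * opnorm (fun Z => W' *m Lh_adj_inv (V^T *m Z))
       * `|W' *m Gh T - Gt T|.
Proof.
move=> _ T0 [_ [uS [X [Y [solX solY [_ imX] [_ imY] [uWV rE]]]]]] _ bijL.
move=> solFh solFt solGh solGt Ph Pt Qh Qt Lh_inv Lh_adj_inv W'.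
have uVW : V^T *m W \in unitmx by rewrite -unitmx_tr trmx_mul trmxK.
have AE : mA r = invmx (W^T *m V) *m W^T *m mA s *m V by rewrite {1}rE.
have NE i : mN r i = invmx (W^T *m V) *m W^T *m mN s i *m V by rewrite {1}rE.
have X0E : mX0 r = invmx (W^T *m V) *m W^T *m mX0 s by rewrite {1}rE.
have CE : mC r = mC s *m V by rewrite {1}rE.
have trPV (B : 'M[R]_n) :
    (invmx (W^T *m V) *m W^T *m B *m V)^T = V^T *m B^T *m W'.
  by rewrite !trmx_mul trmx_inv trmx_mul trmxK mulmxA.
have AtE : (mA r)^T = V^T *m (mA s)^T *m W' by rewrite {1}AE trPV.
have NtE i : (mN r i)^T = V^T *m (mN s i)^T *m W' by rewrite {1}NE trPV.
have PV : invmx (W^T *m V) *m W^T *m V = 1%:M by rewrite -mulmxA mulVmx.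
have VW' : V^T *m W' = 1%:M by rewrite mulmxA mulmxV.
have W'VW : W' *m V^T *m W = W by rewrite -mulmxA mulmxKV.
(* From here on only these identities are needed of W'; as an opaque matrix it
   is not torn apart when products are reassociated. *)
clearbody W'.
(* The iteration is run with (S r)^T acting on the right of the states, and
   with (S r)^-1 acting on the right of the outputs. *)
have [D PtD] : exists D, Pt = V *m D.
  apply: (ode_solution_mulr_im (U := (S r)^T)) T0 _ _ solFt _ imX.
  - by rewrite unitmx_tr.
  - by move=> Z; exact: lyap_mulr.
  - by move: solX; rewrite /state_cov /= trmx_mul mulmxA.
have [E QtE] : exists E, Qt = W *m E.
  apply: (ode_solution_mulr_im (U := invmx (S r))) T0 _ _ solGt _ imY.
  - by rewrite unitmx_inv.
  - by move=> Z; exact: lyap_adj_mulr.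
  - by move: solY; rewrite /output_cov /= mulmxA.
have projF Z : invmx (W^T *m V) *m W^T *m lyap K s r (V *m Z) = lyap K r r Z.
  rewrite /lyap AE !mulmxDr !mulmxA PV mul1mx; congr (_ + _).
  rewrite mulmx_sumr; apply: eq_bigr => i _; rewrite mulmx_sumr.
  by apply: eq_bigr => j _; rewrite -scalemxAr (NE i) !mulmxA.
have projG Z : V^T *m lyap_adj K s r (W' *m Z) = lyap_adj K r r Z.
  rewrite /lyap_adj AtE !mulmxDr !mulmxA VW' mul1mx; congr (_ + _).
  rewrite mulmx_sumr; apply: eq_bigr => i _; rewrite mulmx_sumr.
  by apply: eq_bigr => j _; rewrite -scalemxAr NtE !mulmxA.
have solFh' : ode_solution T (lyap K r r)
    (invmx (W^T *m V) *m W^T *m (mX0 s *m (mX0 r)^T)) Fh.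
  by move: solFh; rewrite /state_cov {1}X0E -!mulmxA.
have solGh' : ode_solution T (lyap_adj K r r) (V^T *m ((mC s)^T *m mC r)) Gh.
  by move: solGh; rewrite /output_cov {1}CE trmx_mul -!mulmxA.
have imFt : V *m (invmx (W^T *m V) *m W^T *m Pt) = Pt.
  by rewrite PtD [_ *m (V *m D)]mulmxA PV mul1mx.
have imGt : W' *m (V^T *m Qt) = Qt.
  by rewrite QtE !mulmxA W'VW.
have [errF errFT] :=
  galerkin_error T0 PV (bij_inj bijL) projF solFh' solFt imFt.
have [errG errGT] :=
  galerkin_error T0 VW' (lyap_adj_inj bijL) projG solGh' solGt imGt.
by [].
Qed.
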